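(* Let $\varepsilon\in(0,1/24)$ and let $p=p(n)$ satisfy $n^{5/8+\varepsilon}\le np\ll n^{2/3}$. For $\ell\in[2k]$ let $$z_\ell=n-(\ell-1)np+\tfrac12(\ell-1)(\ell-2)np^2 .$$ Then one may couple the sequence of basin sizes $(\mathfrak B_1(\ell))_{\ell=1}^{2k}$ of $\mathcal G(n,p)$ with a sequence of independent random variables $(Z_\ell)_{\ell=1}^{2k}$, with $Z_\ell\in\mathrm{Bin}(z_\ell,p)$ for all $\ell\in[2k]$, such that a.a.s. for all $\ell\in[2k]$ we have $$|Z_\ell-\mathfrak B_1(\ell)|\le (np)^{2/5}.$$
   Context: $\mathcal G(n,p)$ is the random graph on $V=\{v_1,\dots,v_n\}$ in which every pair is an edge independently with probability $p$. A.a.s. means with probability tending to $1$ as $n\to\infty$; $f\ll g$ means $f=o(g)$. $[m]=\{1,\dots,m\}$ and $N(v)$ is the set of neighbours of $v$. Set $k=k(n)=\lceil 15p^{-2}(n^{-1}\log n)^{1/2}\rceil$ and $A=\{v_1,\dots,v_{2k}\}$. For $\ell\in[2k]$ the basin of $v_\ell$ is $B_1(\ell)=N(v_\ell)\setminus\big(A\cup\bigcup_{i=1}^{\ell-1}N(v_i)\big)$, and $\mathfrak B_1(\ell)=|B_1(\ell)|$. $Z\in\mathrm{Bin}(z,p)$ means that $Z$ is binomially distributed with parameters $z$ and $p$; quantities such as $z_\ell$ that must be integers are understood to be rounded up or down. *)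

(* Defs.v *)
From mathcomp Require Import all_boot all_order all_algebra.
From mathcomp Require Import all_classical all_reals all_analysis.
Set Implicit Arguments.
Unset Strict Implicit.
Unset Printing Implicit Defensive.
Import Order.TTheory GRing.Theory Num.Theory.
Import numFieldNormedType.Exports.
Local Open Scope classical_set_scope.
Local Open Scope ring_scope.

(* The vertex v_l (l = 1, ..., n) is the ordinal u : 'I_n with u.+1 = l. *)
Definition edge (n : nat) : finType := {e : {set 'I_n} | #|e| == 2%N}.

Definition graph (n : nat) : finType := {set edge n}.

Section Basins.
Variables (n : nat) (G : graph n).

Definition adj (u v : 'I_n) : bool :=
  [exists e : edge n, (e \in G) && (val e == [set u; v]%SET)].

(* N(v_l); it is empty when there is no vertex v_l, i.e. unless 1 <= l <= n. *)
Definition nbr (l : nat) : {set 'I_n} :=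
  [set u : 'I_n | [exists v : 'I_n, (v.+1 == l) && adj v u]]%SET.

Definition initial_vertices (m : nat) : {set 'I_n} :=
  [set u : 'I_n | (u.+1 <= m)%N]%SET.

Definition basin (m l : nat) : {set 'I_n} :=
  (nbr l :\: (initial_vertices m :|: \bigcup_(1 <= i < l) nbr i))%SET.

Definition basin_size (m l : nat) : nat := #|basin m l|.

End Basins.

Section RandomGraph.
Variables (R : realType) (n : nat) (p : R).

Definition gnp_weight (G : graph n) : R :=
  \prod_(e : edge n) (if e \in G then p else 1 - p).

Definition gnp_prob (Q : pred (graph n)) : R :=
  \sum_(G : graph n | Q G) gnp_weight G.

Lemma gnp_prob_total : gnp_prob predT = 1.
Proof.
rewrite /gnp_prob /gnp_weight -bigA_distr big1// => e _.
by rewrite /= subrKC.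
Qed.

End RandomGraph.

Section Asymptotics.
Variables (R : realType) (p : nat -> R).

(* The ceiling is of a nonnegative real, so taking `|_| only casts int to nat. *)
Definition kk (n : nat) : nat :=
  `|Num.ceil (15 * (p n) ^- 2 * Num.sqrt (n%:R^-1 * ln n%:R))|%N.

Definition zz (n l : nat) : R :=
  n%:R - (l%:R - 1) * (n%:R * p n)
  + 2^-1 * ((l%:R - 1) * (l%:R - 2)) * (n%:R * p n ^+ 2).

End Asymptotics.

Definition is_rounding (R : realType) (m : nat) (x : R) : Prop :=
  m%:Z = Num.floor x \/ m%:Z = Num.ceil x.

Section RandomSequences.
Variables (d : measure_display) (T : measurableType d) (R : realType).
Variables (P : probability T R) (m : nat) (X : 'I_m -> {RV P >-> nat}).

Definition mutually_independent : Prop :=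
  forall (J : {set 'I_m}) (A : 'I_m -> set nat),
    P (\bigcap_(i in [set` J]) X i @^-1` A i)
    = (\prod_(i in J) P (X i @^-1` A i))%E.

(* Equality in distribution of two random vectors in the countable set nat^m,
   stated through their joint probability mass functions; index i of X is
   the basin of v_(i+1), and A is {v_1, ..., v_m}. *)
Definition has_basin_law (n : nat) (p : R) : Prop :=
  forall x : 'I_m -> nat,
    P [set w | forall i, X i w = x i]
    = (gnp_prob p
         (fun G : graph n =>
           [forall i : 'I_m, basin_size G m i.+1 == x i]))%:E.

End RandomSequences.

(* Main.v *)
(* The basins are explored one after the other: given the first l - 1 of them,
   the size of the l-th one is Bin(N_l, p), where N_l counts the vertices outside
   A not reached so far.  The coupling takes independent rows of Bernoulli bits,
   one for each l; Z_l counts the ones among the first z_l bits of row l, and the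
   coupled basin size those among the first N_l bits.  Hence Z_l minus the basin
   size is, up to sign, a Bin(|z_l - N_l|, p), and N_l has mean
   mu_l = (n - 2k)(1 - p)^(l-1) up to a standard deviation (l n p)^(1/2).  Since
   z_l is the second-order expansion of n(1 - p)^(l-1), p|z_l - mu_l| is at most
   about n k^3 p^4 = o((np)^(2/5)), and Chebyshev's inequality with a union bound
   over the 2k indices suffices because k = o((np)^(2/5)). *)
From HB Require Import structures.
Require Import Defs.
From mathcomp Require Import all_boot all_order all_algebra.
From mathcomp Require Import all_classical all_reals all_analysis.
From mathcomp Require Import ring lra zify.
Import Order.TTheory GRing.Theory Num.Theory.
Import numFieldNormedType.Exports.
Local Open Scope classical_set_scope.
Local Open Scope ring_scope.

Set Implicit Arguments.
Unset Strict Implicit.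
Unset Printing Implicit Defensive.

(** * Random subsets with independent elements: moments and resampling *)

Section BernoulliSubset.
Variables (R : realType) (p : R) (E : finType).
Implicit Types (A S G H : {set E}) (g : {set E} -> R).

(** For [E := edge n] this is [gnp_weight] up to conversion, so facts about [mean] apply to
    [gnp_prob]. *)
Definition bernoulli_weight G : R := \prod_(e : E) (if e \in G then p else 1 - p).

Definition mean g : R := \sum_(G : {set E}) bernoulli_weight G * g G.

Lemma bernoulli_weight_total : \sum_(G : {set E}) bernoulli_weight G = 1.
Proof. by rewrite -bigA_distr big1 // => e _; rewrite /= subrKC. Qed.

Lemma mean_cst (c : R) : mean (fun=> c) = c.
Proof. by rewrite /mean -mulr_suml bernoulli_weight_total mul1r. Qed.

Lemma eq_mean g g' : g =1 g' -> mean g = mean g'.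
Proof. by move=> gg'; apply: eq_bigr => G _; rewrite gg'. Qed.

Lemma meanD g g' : mean (fun G => g G + g' G) = mean g + mean g'.
Proof. by rewrite -big_split; apply: eq_bigr => G _; rewrite mulrDr. Qed.

Lemma meanZ (c : R) g : mean (fun G => c * g G) = c * mean g.
Proof. by rewrite mulr_sumr; apply: eq_bigr => G _; rewrite mulrCA. Qed.

Lemma mean_sum (I : finType) (g : I -> {set E} -> R) :
  mean (fun G => \sum_i g i G) = \sum_i mean (g i).
Proof. by rewrite exchange_big; apply: eq_bigr => G _; rewrite mulr_sumr. Qed.

Lemma mean_pred (Q : pred {set E}) :
  mean (fun G => (Q G)%:R) = \sum_(G : {set E} | Q G) bernoulli_weight G.
Proof.
by rewrite big_mkcond; apply: eq_bigr => G _; case: (Q G); rewrite ?(mulr1, mulr0).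
Qed.

(** A substitute for conditioning: averaging over an independent [H] with [G] fixed is the
    conditional mean given [G] outside [A]. *)
Definition resample A G H : {set E} := (G :\: A) :|: (H :&: A).

Lemma in_resample A G H e :
  (e \in resample A G H) = if e \in A then e \in H else e \in G.
Proof. by rewrite !inE; case: (e \in A); rewrite /= ?andbT ?andbF ?orbF. Qed.

(** Exchanging the parts in [A] of two independent copies is an involution on pairs that preserves
    the joint weight. *)
Lemma mean_resample A g :
  mean g = mean (fun G => mean (fun H => g (resample A G H))).
Proof.
pose swap (u : {set E} * {set E}) := (resample A u.1 u.2, resample A u.2 u.1).
have swapK : involutive swap.
  case=> G H; congr pair; apply/setP => e; rewrite !in_resample;
  by case: (e \in A).
have weight_swap G H : bernoulli_weight (resample A G H) *
    bernoulli_weight (resample A H G) = bernoulli_weight G * bernoulli_weight H.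
  rewrite /bernoulli_weight -!big_split; apply: eq_bigr => e _.
  by rewrite /= !in_resample; case: (e \in A); rewrite // mulrC.
transitivity (\sum_(u : {set E} * {set E})
    (bernoulli_weight u.1 * bernoulli_weight u.2) * g u.1).
  rewrite -(pair_bigA _ (fun G H => bernoulli_weight G * bernoulli_weight H * g G)) /=.
  apply: eq_bigr => G _; rewrite -mulr_suml -mulr_sumr.
  by rewrite bernoulli_weight_total mulr1.
rewrite (reindex_inj (inv_inj swapK)) /=.
under eq_bigr do rewrite weight_swap.
rewrite -(pair_bigA _ (fun G H =>
  bernoulli_weight G * bernoulli_weight H * g (resample A G H))) /=.
by apply: eq_bigr => G _; rewrite mulr_sumr; apply: eq_bigr => H _; rewrite mulrA.
Qed.

(** The probability generating function of the size of the intersection: expanding a product with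
    one binomial factor per element of [E] runs over all subsets. *)
Lemma card_setI_genfun S :
  \sum_(G : {set E}) bernoulli_weight G *: 'X^#|G :&: S|
    = (p *: 'X + (1 - p)%:P) ^+ #|S|.
Proof.
rewrite -prodr_const.
rewrite (big_mkcond (fun e => e \in S)) /=.
transitivity (\prod_(e : E) (p *: (if e \in S then 'X else 1) + (1 - p)%:P : {poly R})).
  rewrite bigA_distr; apply: eq_bigr => G _.
  have -> : 'X^#|G :&: S| =
      \prod_(e : E) (if e \in G then (if e \in S then 'X else 1) else 1) :> {poly R}.
    rewrite -prodr_const big_mkcond /=; apply: eq_bigr => e _.
    by rewrite inE; case: (e \in G).
  rewrite -mul_polyC rmorph_prod -big_split; apply: eq_bigr => e _ /=.
  by case: (e \in G); [rewrite mul_polyC | rewrite mulr1].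
apply: eq_bigr => e _; case: (e \in S) => //.
by rewrite alg_polyC -polyCD subrKC.
Qed.

Lemma card_setI_law S j :
  mean (fun H => (#|H :&: S| == j)%:R) = binomial_pmf #|S| p j.
Proof.
transitivity ((\sum_(G : {set E}) bernoulli_weight G *: 'X^#|G :&: S|)`_j).
  rewrite coef_sum; apply: eq_bigr => G _.
  by rewrite coefZ coefXn eq_sym.
rewrite card_setI_genfun addrC exprDn coef_sum /binomial_pmf.
under eq_bigr => i _ do rewrite exprZn -polyC_exp mul_polyC
  coefMn !coefZ coefXn.
have [jS|Sj] := ltnP j #|S|.+1; last first.
  rewrite bin_small // mulr0n big1 // => i _.
  suff -> : (j == i :> nat) = false by rewrite !mulr0 mul0rn.
  by apply/negbTE; rewrite neq_ltn (leq_trans (ltn_ord i) Sj) orbT.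
rewrite (bigD1 (Ordinal jS)) //= eqxx big1 ?addr0.
  by rewrite mulr1 mulrC.
move=> i ij; suff -> : (j == i :> nat) = false by rewrite !mulr0 mul0rn.
by apply/negbTE; apply: contra ij => /eqP ji; apply/eqP/val_inj.
Qed.

(** The first two derivatives of the generating function at 1 give the mean and the second factorial
    moment. The offset [c] makes this a split into squared bias and variance. *)
Lemma card_setI_second_moment S (c : R) :
  mean (fun H => (c + (#|H :&: S|%:R - p * #|S|%:R)) ^+ 2)
    = c ^+ 2 + #|S|%:R * p * (1 - p).
Proof.
set n := #|S|; pose F : {poly R} := p *: 'X + (1 - p)%:P.
have F1 : F.[1] = 1 by rewrite hornerD hornerZ hornerX hornerC mulr1 subrKC.
have F' : F^`() = p%:P by rewrite derivD derivZ derivX derivC addr0 alg_polyC.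
have M1 : mean (fun H => #|H :&: S|%:R) = n%:R * p.
  have := congr1 (fun q : {poly R} => q^`().[1]) (card_setI_genfun S).
  rewrite /= -/F linear_sum horner_sum deriv_exp F' hornerMn hornerM horner_exp.
  rewrite F1 expr1n hornerC mulr1 -mulr_natl => <-; apply: eq_bigr => G _.
  by rewrite /= derivZ derivXn hornerZ hornerMn hornerXn expr1n.
have M2 : mean (fun H => #|H :&: S|%:R * #|H :&: S|.-1%:R) = n%:R * n.-1%:R * p ^+ 2.
  have := congr1 (fun q : {poly R} => q^`()^`().[1]) (card_setI_genfun S).
  rewrite /= -/F !linear_sum horner_sum deriv_exp F' => e.
  transitivity ((p%:P * F ^+ n.-1 *+ n)^`().[1]).
    rewrite -e; apply: eq_bigr => G _; rewrite /= !derivZ derivXn derivMn derivXn.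
    by rewrite hornerZ !hornerMn hornerXn expr1n -mulrnA natrM; ring.
  rewrite derivMn mul_polyC derivZ deriv_exp F' hornerMn hornerZ hornerMn hornerM.
  rewrite horner_exp F1 expr1n hornerC mulr1 -(mulr_natr _ n) -(mulr_natr p n.-1).
  by ring.
pose a := 1 + 2 * (c - p * n%:R).
transitivity (mean (fun H => #|H :&: S|%:R * #|H :&: S|.-1%:R + (a * #|H :&: S|%:R +
    (c - p * n%:R) ^+ 2))).
  (* The predecessor truncates at 0, so the empty intersection is treated apart. *)
  apply: eq_mean => H; case: #|H :&: S| => [|k]; first by rewrite /a; ring.
  by rewrite -natr1 /= /a; ring.
rewrite meanD meanD meanZ mean_cst M1 M2 /a.
case: n {M1 M2 a} => [|n]; first by ring.
by rewrite -natr1 /=; ring.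
Qed.

(** Chain rule, by induction: redrawing the last block leaves the earlier events alone, and given
    these the last event has a constant probability, which factors out. *)
Lemma mean_chain (m : nat) (A : nat -> {set E}) (Q : nat -> pred {set E})
    (c : nat -> R) :
  (forall i i' G H, (i < m)%N -> (i' < i)%N ->
     Q i' (resample (A i) G H) = Q i' G) ->
  (forall i G, (i < m)%N -> (forall i', (i' < i)%N -> Q i' G) ->
     mean (fun H => (Q i (resample (A i) G H))%:R) = c i) ->
  mean (fun G => [forall i : 'I_m, Q i G]%:R) = \prod_(i < m) c i.
Proof.
elim: m => [|m IH] past law.
  rewrite big_ord0 -[RHS](mean_cst 1); apply: eq_mean => G.
  by have -> : [forall i : 'I_0, Q i G] by apply/forallP => -[].
rewrite (mean_resample (A m)) big_ord_recr /=.
rewrite -IH => [|i i' G H im i'i|i G im Qi]; last 2 first.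
- by apply: past => //; exact: ltnW.
- by apply: law => //; exact: ltnW.
rewrite mulrC -meanZ; apply: eq_mean => G.
(* If an earlier event fails at [G], it still fails after resampling, and both sides vanish. *)
have [/forallP Qm|NQm] := boolP [forall i : 'I_m, Q i G]; last first.
  rewrite mulr0 -[RHS](mean_cst 0); apply: eq_mean => H.
  suff /negbTE -> : ~~ [forall i : 'I_m.+1, Q i (resample (A m) G H)] by [].
  apply: contra NQm => /forallP Qm; apply/forallP => i.
  by have := Qm (widen_ord (leqnSn m) i); rewrite /= past.
rewrite mulr1 -(law m G) => [|//|i im]; last exact: (Qm (Ordinal im)).
apply: eq_mean => H; congr (_%:R : R); congr nat_of_bool.
apply/forallP/idP => [/(_ ord_max)//|Qmm i].
have := ltn_ord i; rewrite ltnS leq_eqVlt => /orP[/eqP ->//|im].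
by rewrite past //; exact: (Qm (Ordinal im)).
Qed.

End BernoulliSubset.

(** * Successive exploration of fresh blocks *)

Lemma setI_resample_sub (E : finType) (A S G H : {set E}) :
  S \subset A -> resample A G H :&: S = H :&: S.
Proof.
move=> /fintype.subsetP SA; apply/setP => e; rewrite !finset.in_setI in_resample.
by have [/SA ->|] := boolP (e \in S); rewrite ?andbF.
Qed.

Lemma setI_resample_disjoint (E : finType) (A S G H : {set E}) :
  {in S, forall e, e \notin A} -> resample A G H :&: S = G :&: S.
Proof.
move=> SA; apply/setP => e; rewrite !finset.in_setI in_resample.
by have [/SA/negbTE ->|] := boolP (e \in S); rewrite ?andbF.
Qed.

(* The sets [S i G] are explored one after the other: [S i G] may depend on the
   elements of [G] discovered before, but not on those of the fresh block [A i]. *)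
Lemma exploration_law (R : realType) (p : R) (E : finType) (m M : nat)
    (A : nat -> {set E}) (S : nat -> {set E} -> {set E}) (x : nat -> nat) :
  (forall i G, (i < m)%N -> S i G \subset A i) ->
  (forall i i' G H, (i < m)%N -> (i' <= i)%N ->
     S i' (resample (A i) G H) = S i' G) ->
  (forall i i' G, (i < m)%N -> (i' < i)%N -> {in S i' G, forall e, e \notin A i}) ->
  (forall i G, (i < m)%N ->
     #|S i G| = (M - \sum_(i' < i) #|G :&: S i' G|)%N) ->
  mean p (fun G => [forall i : 'I_m, #|G :&: S i G| == x i]%:R)
    = \prod_(i < m) binomial_pmf (M - \sum_(i' < i) x i') p (x i).
Proof.
move=> SA Sfresh Sdisj Scard.
apply: (mean_chain (A := A) (Q := fun i G => #|G :&: S i G| == x i)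
  (c := fun i => binomial_pmf (M - \sum_(i' < i) x i') p (x i))).
- move=> i i' G H im i'i.
  by rewrite Sfresh ?(ltnW i'i) // setI_resample_disjoint //; exact: Sdisj.
- move=> i G im Qi; transitivity (mean p (fun H => (#|H :&: S i G| == x i)%:R)).
    by apply: eq_mean => H; rewrite Sfresh // setI_resample_sub // SA.
  (* The earlier events, assumed in [Qi], turn the sizes observed in [Scard] into the prescribed
     values [x i']. *)
  rewrite card_setI_law Scard //; congr binomial_pmf; congr subn.
  by apply: eq_bigr => i' _; apply/eqP/Qi.
Qed.

(** * Exploration of the basins in the random graph *)

Section GraphExploration.
Variables (n m : nat).
Implicit Types (G H : graph n) (U : {set 'I_n}).

(** The ordinal [u] is the vertex v_(u+1), so this is the complement of A = {v_1, ..., v_m}. *)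
Definition outer : {set 'I_n} := [set u : 'I_n | (m <= u)%N]%SET.

(* The edges from v_(i+1) to U. *)
Definition star (i : nat) U : {set edge n} :=
  [set e : edge n | [exists v : 'I_n, (v == i :> nat) &&
    [exists u in U, val e == [set v; u]%SET]]]%SET.

(** The candidates for the basin of v_(i+1), once v_1, ..., v_i are explored. *)
Definition unreached G (i : nat) : {set 'I_n} :=
  (outer :\: \bigcup_(1 <= l < i.+1) nbr G l)%SET.

Lemma starP i U e : reflect
  (exists2 v : 'I_n, v = i :> nat & exists2 u, u \in U & val e = [set v; u]%SET)
  (e \in star i U).
Proof.
rewrite inE; apply: (iffP existsP) => [[v /andP[/eqP vi /exists_inP[u uU /eqP eu]]]|].
  by exists v => //; exists u.
case=> v vi [u uU eu]; exists v; rewrite vi eqxx /=.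
by apply/exists_inP; exists u; rewrite ?eu.
Qed.

Lemma card_outer : #|outer| = (n - m)%N.
Proof.
rewrite -sum1_card -[RHS]muln1 -sum_nat_const_nat.
by rewrite (big_nat_widenl _ 0) // big_mkord; apply: eq_bigl => u; rewrite inE.
Qed.

(** An edge between A and its complement has a single endpoint in A, hence determines its centre;
    stars with distinct centres in A and outer leaves are therefore disjoint. *)
Lemma star_edgeP i U (v u : 'I_n) (e : edge n) : (i < m)%N -> U \subset outer ->
  (m <= u)%N -> val e = [set v; u]%SET -> (v < m)%N ->
  e \in star i U = (v == i :> nat) && (u \in U).
Proof.
move=> im /fintype.subsetP Uo mu ev vm; apply/starP/andP => [[v' v'i [u' u'U]]|[/eqP vi uU]].
  rewrite ev => /setP vu; have := Uo _ u'U; rewrite inE => mu'.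
  have := vu v; have := vu u; rewrite !inE !eqxx orbT.
  have uv' : u != v' by apply/eqP => uv'; move: mu; rewrite uv' v'i leqNgt im.
  have vu' : v != u' by apply/eqP => vu'; move: mu'; rewrite -vu' leqNgt vm.
  rewrite (negbTE uv') (negbTE vu') orbF /= => /esym/eqP -> /esym/eqP ->.
  by rewrite v'i.
by exists v => //; exists u.
Qed.

Lemma card_star i U : (i < m)%N -> (i < n)%N -> U \subset outer ->
  #|star i U| = #|U|.
Proof.
move=> im ltin /fintype.subsetP Uo; pose v := Ordinal ltin.
have vU u : u \in U -> v != u.
  move=> /Uo; rewrite inE => mu; apply/eqP => vu.
  by move: mu; rewrite -vu leqNgt im.
have -> : #|U| = #|[set [set v; u] | u in U]%SET|.
  rewrite card_in_imset // => u u' uU u'U /setP/(_ u).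
  by rewrite !inE eqxx orbT eq_sym (negbTE (vU u uU)) /= => /esym/eqP.
rewrite -(card_imset _ val_inj); apply: eq_card => /= X.
apply/imsetP/imsetP => [[e /starP[w wi [u uU eu]] ->]|[u uU ->]].
  by exists u => //; rewrite eu; congr [set _; u]%SET; apply: val_inj.
have vu2 : #|[set v; u]%SET| == 2%N by rewrite cards2 vU.
by exists (Sub [set v; u]%SET vu2) => //; apply/starP; exists v => //; exists u.
Qed.

(** Converts edges present in a star into neighbours of its centre, so that basin sizes become sizes
    of intersections with [G]. *)
Lemma setI_star G i U : G :&: star i U = star i (nbr G i.+1 :&: U).
Proof.
apply/setP => e; rewrite inE; apply/andP/starP.
  case=> eG /starP[v vi [u uU eu]]; exists v => //; exists u => //.
  rewrite !inE uU andbT; apply/existsP; exists v; rewrite -vi eqxx /=.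
  by apply/existsP; exists e; rewrite eG eu /=.
case=> v vi [u /finset.setIP[+ uU] eu].
rewrite {1}inE => /existsP[w /andP[wi /existsP[e' /andP[e'G e'w]]]].
have wv : w = v by apply: ord_inj; move: wi => /eqP[->].
have -> : e = e' by apply/val_inj; rewrite eu (eqP e'w) wv.
by split=> //; apply/starP; exists v => //; exists u; rewrite // (eqP e'w) wv.
Qed.

Lemma basinE G i : basin G m i.+1 = nbr G i.+1 :&: unreached G i.
Proof.
apply/setP => u; rewrite !inE negb_or -leqNgt.
by rewrite [LHS]andbC; congr andb; rewrite andbC.
Qed.

Lemma unreached_sub_outer G i : unreached G i \subset outer.
Proof. exact: finset.subsetDl. Qed.

(** Passing from [i] to [i.+1] removes exactly the basin of v_(i+1). *)
Lemma card_unreached G i :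
  #|unreached G i| = (n - m - \sum_(i' < i) basin_size G m i'.+1)%N.
Proof.
elim: i => [|i IH]; first by rewrite big_ord0 subn0 /unreached big_geq // finset.setD0 card_outer.
rewrite big_ord_recr /= subnDA -IH /basin_size basinE finset.setIC.
have -> : unreached G i.+1 = unreached G i :\: nbr G i.+1.
  by rewrite /unreached big_nat_recr //= finset.setDDl.
by rewrite cardsD.
Qed.

(** Every redrawn edge joins v_(i+1) to an outer vertex, whereas [l <= i] makes v_l an earlier
    vertex of A. *)
Lemma nbr_resample i G H l (u : 'I_n) : (i < m)%N -> (l <= i)%N -> (m <= u)%N ->
  u \in nbr (resample (star i outer) G H) l = (u \in nbr G l).
Proof.
move=> im li mu; rewrite !inE; apply: eq_existsb => v.
have [/eqP vl|//] := boolP (v.+1 == l :> nat); rewrite /=.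
apply: eq_existsb => e; have [/eqP ev|] := boolP (val e == _); rewrite ?andbF //.
rewrite !andbT in_resample (@star_edgeP _ _ v u) //.
- by rewrite (_ : (v == i :> nat) = false) //; apply/negbTE; rewrite neq_ltn vl li.
- by apply: ltn_trans im; rewrite vl.
Qed.

Lemma unreached_resample i i' G H : (i < m)%N -> (i' <= i)%N ->
  unreached (resample (star i outer) G H) i' = unreached G i'.
Proof.
move=> im i'i; apply/setP => u; rewrite !finset.in_setD.
have [uo|] := boolP (u \in outer); rewrite ?andbF // !andbT; congr negb.
have inU (X Y : {set 'I_n}) : (u \in X :|: Y) = (u \in X) || (u \in Y).
  exact: finset.in_setU.
rewrite !(big_morph (fun X : {set 'I_n} => u \in X) inU (finset.in_set0 _)).
apply: eq_big_nat => l /andP[_ li']; apply: nbr_resample => //.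
  by rewrite -ltnS (leq_trans li').
by rewrite inE in uo.
Qed.

(** The fresh block of step [i] consists of the edges from v_(i+1) to vertices outside A; the part
    of it over the unreached vertices is the set explored. *)
Lemma basin_size_law (R : realType) (p : R) (x : nat -> nat) :
  gnp_prob p (fun G : graph n => [forall i : 'I_m, basin_size G m i.+1 == x i])
    = \prod_(i < m) binomial_pmf (n - m - \sum_(i' < i) x i') p (x i).
Proof.
have sizeE G i : (i < m)%N ->
    #|G :&: star i (unreached G i)| = basin_size G m i.+1.
  move=> im; rewrite setI_star -basinE.
  have [ltin|nlei] := ltnP i n.
    by rewrite card_star // basinE finset.subIset // unreached_sub_outer orbT.
  (* If [n <= i < m], there is no vertex v_(i+1) and no vertex outside A: star and basin are both
     empty. *)
  have -> : star i (basin G m i.+1) = finset.set0.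
    apply/setP => e; rewrite finset.in_set0; apply/negP => /starP[v vi _].
    by move: nlei; rewrite -vi leqNgt ltn_ord.
  rewrite cards0; apply/esym/eqP; rewrite cards_eq0 basinE -finset.subset0.
  apply/fintype.subsetP => u; rewrite !inE => /andP[_ /andP[_ mu]].
  by have := leq_trans (ltn_trans im (leq_ltn_trans mu (ltn_ord u))) nlei; rewrite ltnn.
rewrite -(@exploration_law R p (edge n) m (n - m)%N (fun i => star i outer)
  (fun i G => star i (unreached G i))).
- rewrite mean_pred; apply: eq_bigl => G; apply: eq_forallb => i.
  by rewrite sizeE.
- move=> i G im; apply/fintype.subsetP => e /starP[v vi [u uU eu]]; apply/starP; exists v => //.
  by exists u => //; exact: (fintype.subsetP (unreached_sub_outer G i)).
- by move=> i i' G H im i'i; rewrite unreached_resample.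
- move=> i i' G im i'i e /starP[v vi' [u uU eu]].
  have := fintype.subsetP (unreached_sub_outer G i') _ uU; rewrite inE => mu.
  rewrite (@star_edgeP _ _ v u) // ?vi' ?(ltn_trans i'i) //.
  by rewrite (ltn_eqF i'i).
- move=> i G im; have [ltin|nlei] := ltnP i n.
    rewrite card_star ?unreached_sub_outer // card_unreached; congr subn.
    by apply: eq_bigr => i' _; rewrite sizeE // (ltn_trans _ im).
  (* Again [n <= i < m]: the truncated difference [n - m] is 0, as is the size of the empty star. *)
  rewrite (eqP (_ : (n - m)%N == 0)%N) ?sub0n ?subn_eq0 ?(leq_trans nlei) ?(ltnW im) //.
  apply/eqP; rewrite cards_eq0 -finset.subset0; apply/fintype.subsetP => e /starP[v vi _].
  by move: nlei; rewrite -vi leqNgt ltn_ord.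
Qed.

End GraphExploration.

(** * Realisation on a probability space *)

Section BernoulliProbability.
Variables (R : realType) (p : R) (E : finType).
Hypothesis p01 : 0 <= p <= 1.
Implicit Types (G H : {set E}) (g : {set E} -> R).

Lemma bernoulli_weight_ge0 G : 0 <= bernoulli_weight p G.
Proof.
by case/andP: p01 => p0 p1; apply: prodr_ge0 => e _; case: ifP; rewrite ?subr_ge0.
Qed.

Lemma le_mean g g' : (forall G, g G <= g' G) -> mean p g <= mean p g'.
Proof.
by move=> gg'; apply: ler_sum => G _; rewrite ler_wpM2l ?bernoulli_weight_ge0.
Qed.

(** Subsets are enumerated by natural numbers, each carrying a Dirac mass of its weight; numbers
    past the end of the list have no mass. Every set of naturals is measurable, so any function of
    [f w] gives a random variable. *)
Lemma bernoulli_probability_space :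
  exists (P : probability nat R) (f : nat -> {set E}),
    forall Q : pred {set E},
      P [set w | Q (f w)] = (mean p (fun G => (Q G)%:R))%:E.
Proof.
pose f j : {set E} := nth finset.set0 (enum (@predT {set E})) j.
pose m_ j : {measure set nat -> \bar R} :=
  mscale (NngNum (bernoulli_weight_ge0 (f j))) (\d_j).
pose mu := msum m_ (size (enum (@predT {set E}))).
have muE (Q : pred {set E}) :
    mu [set w | Q (f w)] = (mean p (fun G => (Q G)%:R))%:E.
  rewrite /mu /msum /mean -sumEFin -[in RHS]big_enum /= (big_nth finset.set0) big_mkord.
  apply: eq_bigr => j _; rewrite /m_ /mscale /= diracE -EFinM -/(f j).
  congr (_ * _)%:E.
  by have [Qj|Qj] := boolP (Q (f j)); [rewrite mem_set | rewrite memNset //; apply/negP].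
have mu1 : mu setT = 1%E.
  have := muE predT; rewrite /= mean_cst => <-; congr (mu _).
  by apply/seteqP; split.
pose is_prob := Measure_isProbability.Build _ _ _ mu mu1.
pose P : probability nat R := HB.pack mu is_prob.
by exists P, f.
Qed.

End BernoulliProbability.

(** * The coupled model built on independent rows of bits *)

Section CoupledModel.
Variables (R : realType) (p : R) (m M N0 : nat) (z : nat -> nat).
Hypothesis p01 : 0 <= p <= 1.
Hypothesis N0M : (N0 <= M)%N.
Hypothesis zM : forall i, (i < m)%N -> (z i <= M)%N.
Local Notation cells := ('I_m * 'I_M)%type.
Implicit Types (G H : {set cells}).

Definition bit_row (i N : nat) : {set cells} :=
  [set e : cells | (e.1 == i :> nat) && (e.2 < N)%N]%SET.

(* Plays the role of the number of vertices outside A not adjacent to v_1, ..., v_i. *)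
Fixpoint remaining G (i : nat) : nat :=
  if i is j.+1 then (remaining G j - #|G :&: bit_row j (remaining G j)|)%N else N0.

Definition coupled_basin G i := #|G :&: bit_row i (remaining G i)|.

Definition coupled_binomial G i := #|G :&: bit_row i (z i)|.

Lemma card_row i N : (i < m)%N -> (N <= M)%N -> #|bit_row i N| = N.
Proof.
move=> im NM; rewrite -[RHS](card_ord N).
pose f (j : 'I_N) : cells := (Ordinal im, widen_ord NM j).
have f_inj : injective f by move=> j j' [] /val_inj.
rewrite -(card_imset _ f_inj); apply: eq_card => -[i' j]; apply/idP/imsetP.
  rewrite inE /= => /andP[/eqP i'i jN]; exists (Ordinal jN) => //.
  by congr pair; apply: val_inj.
by move=> [j' _ [-> ->]]; rewrite inE /= eqxx /=.
Qed.

Lemma row_sub i N : bit_row i N \subset bit_row i M.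
Proof.
by apply/fintype.subsetP => e; rewrite !inE => /andP[-> _] /=.
Qed.

Lemma row_notin i i' N : (i' < i)%N -> {in bit_row i' N, forall e, e \notin bit_row i M}.
Proof.
move=> i'i e; rewrite !inE => /andP[/eqP -> _].
by rewrite negb_and (ltn_eqF i'i).
Qed.

Lemma resample_row i N G H : resample (bit_row i M) G H :&: bit_row i N = H :&: bit_row i N.
Proof. by apply: setI_resample_sub; exact: row_sub. Qed.

Lemma resample_row_lt i i' N G H : (i' < i)%N ->
  resample (bit_row i M) G H :&: bit_row i' N = G :&: bit_row i' N.
Proof. by move=> i'i; apply: setI_resample_disjoint; exact: row_notin. Qed.

Lemma remaining_resample i i' G H : (i' <= i)%N ->
  remaining (resample (bit_row i M) G H) i' = remaining G i'.
Proof.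
elim: i' => //= i' IH i'i.
by rewrite IH ?(ltnW i'i) // resample_row_lt.
Qed.

Lemma remainingE G i :
  remaining G i = (N0 - \sum_(i' < i) coupled_basin G i')%N.
Proof.
elim: i => [|i IH]; first by rewrite big_ord0 subn0.
by rewrite big_ord_recr /= subnDA -IH.
Qed.

Lemma remaining_le G i : (remaining G i <= N0)%N.
Proof. by rewrite remainingE leq_subr. Qed.

(** With [N0 = n - m] this is the product found for the graph basins, which identifies the two joint
    laws. *)
Lemma coupled_basin_law (x : nat -> nat) :
  mean p (fun G => [forall i : 'I_m, coupled_basin G i == x i]%:R)
    = \prod_(i < m) binomial_pmf (N0 - \sum_(i' < i) x i') p (x i).
Proof.
apply: (@exploration_law _ _ _ _ _ (fun i => bit_row i M)
  (fun i G => bit_row i (remaining G i))).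
- by move=> i G _; exact: row_sub.
- by move=> i i' G H _ i'i; rewrite remaining_resample.
- by move=> i i' G _ i'i; exact: row_notin.
- move=> i G im; rewrite card_row //; last exact: leq_trans (remaining_le _ _) N0M.
  exact: remainingE.
Qed.

(** The prefix lengths [z i] are deterministic, so the event for [i] depends on row [i] alone. *)
Lemma coupled_binomial_indep (Q : nat -> pred nat) :
  mean p (fun G => [forall i : 'I_m, Q i (coupled_binomial G i)]%:R)
    = \prod_(i < m) mean p (fun G => (Q i (coupled_binomial G i))%:R).
Proof.
apply: (mean_chain (A := fun i => bit_row i M)
  (Q := fun i G => Q i (coupled_binomial G i))
  (c := fun i => mean p (fun G => (Q i (coupled_binomial G i))%:R))).
- by move=> i i' G H im i'i; rewrite /coupled_binomial resample_row_lt.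
- move=> i G im _; apply: eq_mean => H.
  by rewrite /coupled_binomial resample_row.
Qed.

Lemma coupled_binomial_law i (Q : pred nat) : (i < m)%N ->
  mean p (fun G => (Q (coupled_binomial G i))%:R)
    = \sum_(k < (z i).+1) binomial_pmf (z i) p k * (Q k)%:R.
Proof.
move=> im; transitivity (mean p (fun G => \sum_(k < (z i).+1)
    ((Q k)%:R * (#|G :&: bit_row i (z i)| == k)%:R))).
  apply: eq_mean => G; rewrite /coupled_binomial.
  have Zz : (#|G :&: bit_row i (z i)| < (z i).+1)%N.
    by rewrite ltnS -[leqRHS](card_row im (zM im)) subset_leq_card // finset.subsetIr.
  rewrite (bigD1 (Ordinal Zz)) //= eqxx mulr1 big1 ?addr0 // => k kZ.
  suff -> : (#|G :&: bit_row i (z i)| == k) = false by rewrite mulr0.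
  by apply: contraNF kZ => /eqP Zk; apply/eqP/val_inj.
rewrite mean_sum; apply: eq_bigr => k _.
by rewrite meanZ card_setI_law card_row ?zM // mulrC.
Qed.

(** The mean of [remaining G i]: each vertex survives a step with probability [1 - p]. *)
Definition expected_remaining (i : nat) : R := N0%:R * (1 - p) ^+ i.

Local Notation mu := expected_remaining.

(** Given the past, a step multiplies the deviation by [1 - p] and adds a centred binomial error of
    variance at most [N0 * p]; as the error has conditional mean 0, the squares add. *)
Lemma remaining_variance i : (i <= m)%N ->
  mean p (fun G => ((remaining G i)%:R - mu i) ^+ 2) <= i%:R * (N0%:R * p).
Proof.
case/andP: p01 => p0 p1.
elim: i => [_|i IH im].
  rewrite mul0r -[leRHS](mean_cst p cells 0); apply: le_mean => // G.
  by rewrite /expected_remaining expr0 mulr1 subrr expr0n.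
rewrite (mean_resample p (bit_row i M)) -natr1 mulrDl mul1r.
have := IH (ltnW im); rewrite -(lerD2r (N0%:R * p)); apply: le_trans.
rewrite -[X in _ + X](mean_cst p cells) -meanD; apply: le_mean => // G.
set r := remaining G i.
have rN0 : (r <= N0)%N := remaining_le G i.
have -> : mean p (fun H => ((remaining (resample (bit_row i M) G H) i.+1)%:R - mu i.+1) ^+ 2)
   = mean p (fun H => (- ((1 - p) * (r%:R - mu i)) +
       (#|H :&: bit_row i r|%:R - p * #|bit_row i r|%:R)) ^+ 2).
  apply: eq_mean => H /=; rewrite remaining_resample // resample_row -/r.
  rewrite card_row ?(leq_trans rN0) // natrB; last first.
    by rewrite -[leqRHS](@card_row i) ?(leq_trans rN0) // subset_leq_card // finset.subsetIr.
  by rewrite /expected_remaining (exprS (1 - p) i); ring.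
rewrite card_setI_second_moment card_row ?(leq_trans rN0) // sqrrN exprMn.
have r0 : 0 <= (r%:R : R) by [].
have rN : r%:R <= (N0%:R : R) by rewrite ler_nat.
apply: lerD.
  rewrite ler_piMl ?sqr_ge0 // exprn_ile1 ?subr_ge0 //; lra.
by rewrite -[leRHS]mulr1 ler_pM ?mulr_ge0 ?ler_pM ?subr_ge0 //; lra.
Qed.

Lemma card_setI_row_diff i N N' H : (i < m)%N -> (N <= N')%N -> (N' <= M)%N ->
  #|H :&: bit_row i N'| = (#|H :&: bit_row i N| + #|H :&: (bit_row i N' :\: bit_row i N)|)%N
  /\ #|bit_row i N' :\: bit_row i N| = (N' - N)%N.
Proof.
move=> im NN' N'M.
have sub : bit_row i N \subset bit_row i N'.
  apply/fintype.subsetP => e; rewrite !inE => /andP[-> eN] /=; exact: leq_trans NN'.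
split; last first.
  by rewrite cardsD (finset.setIidPr sub) !card_row // (leq_trans NN').
rewrite -(cardsID (bit_row i N) (H :&: bit_row i N')) -finset.setIA (finset.setIidPr sub).
by rewrite finset.setIDA.
Qed.

(** Given the past, the difference is up to sign binomial with [|z i - r|] trials. Centring it at
    [p * (z i - mu i)] leaves a bias of absolute value [p * |r - mu i|], controlled by
    [remaining_variance]. *)
Lemma coupling_second_moment i : (i < m)%N ->
  mean p (fun G => ((coupled_binomial G i)%:R - (coupled_basin G i)%:R
                    - p * ((z i)%:R - mu i)) ^+ 2)
  <= 2 * p ^+ 2 * (i%:R * (N0%:R * p)) + p * `|(z i)%:R - mu i| + 1.
Proof.
move=> im; case/andP: (p01) => p0 p1.
rewrite (mean_resample p (bit_row i M)).
apply: (@le_trans _ _ (mean p (fun G => 2 * p ^+ 2 * ((remaining G i)%:R - mu i) ^+ 2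
    + (p * `|(z i)%:R - mu i| + 1)))); last first.
  rewrite meanD meanZ mean_cst -addrA lerD2r ler_wpM2l ?mulr_ge0 ?sqr_ge0 //.
  exact: remaining_variance (ltnW im).
apply: le_mean => // G; set r := remaining G i.
have rM : (r <= M)%N := leq_trans (remaining_le G i) N0M.
have -> : mean p (fun H => ((coupled_binomial (resample (bit_row i M) G H) i)%:R -
     (coupled_basin (resample (bit_row i M) G H) i)%:R - p * ((z i)%:R - mu i)) ^+ 2)
   = (p * (r%:R - mu i)) ^+ 2 + `|(z i)%:R - r%:R| * p * (1 - p).
  have [rz|zr] := leqP r (z i).
    have diff H := card_setI_row_diff H im rz (zM im).
    rewrite -natrB // normr_nat -(diff finset.set0).2.
    rewrite -[in RHS]sqrrN -card_setI_second_moment; apply: eq_mean => H.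
    rewrite /coupled_binomial /coupled_basin !resample_row remaining_resample // -/r.
    rewrite (diff H).1 (diff H).2 natrD natrB //; congr (_ ^+ 2); ring.
  have diff H := card_setI_row_diff H im (ltnW zr) rM.
  rewrite distrC -natrB ?(ltnW zr) // normr_nat -(diff finset.set0).2.
  rewrite -card_setI_second_moment; apply: eq_mean => H.
  rewrite /coupled_binomial /coupled_basin !resample_row remaining_resample // -/r.
  rewrite -sqrrN (diff H).1 (diff H).2 natrD natrB ?(ltnW zr) //; congr (_ ^+ 2); ring.
set a := r%:R - mu i; set b := (z i)%:R - mu i.
have zrab : `|(z i)%:R - r%:R| <= `|b| + `|a|.
  by rewrite (_ : _ - _ = b - a) ?ler_normB // /a /b; ring.
have A1 : `|(z i)%:R - r%:R| * p * (1 - p) <= p * (`|b| + `|a|).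
  apply: (@le_trans _ _ (`|(z i)%:R - r%:R| * p)).
    by rewrite ler_piMr ?mulr_ge0 //; lra.
  by rewrite mulrC ler_wpM2l.
(* By y <= y^2 + 1 the linear term joins the squared bias, whence the factor 2 and the summand 1. *)
have A2 : p * `|a| <= p ^+ 2 * a ^+ 2 + 1.
  rewrite -[a ^+ 2]real_normK ?num_real // -exprMn.
  by set y := p * `|a|; nra.
apply: le_trans (lerD (lexx _) A1) _; rewrite exprMn; lra.
Qed.

(** Chebyshev and a union bound: the centre accounts for at most t/2, so a failure at [i] forces
    [|dev G i|] above t/2, and its term in the sum exceeds 1. *)
Lemma coupling_tail (t : R) : 0 < t ->
  (forall i, (i < m)%N -> p * `|(z i)%:R - mu i| <= t / 2) ->
  1 - m%:R * (4 / t ^+ 2 * (2 * p ^+ 2 * (m%:R * (N0%:R * p)) + t / 2 + 1))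
  <= mean p (fun G => [forall i : 'I_m,
       `|(coupled_binomial G i)%:R - (coupled_basin G i)%:R : R| <= t]%:R).
Proof.
move=> t0 small; case/andP: (p01) => p0 p1.
rewrite lerBlDr -lerBlDl.
pose dev G i := (coupled_binomial G i)%:R - (coupled_basin G i)%:R
                - p * ((z i)%:R - mu i).
apply: (@le_trans _ _ (mean p (fun G => \sum_(i < m) 4 / t ^+ 2 * dev G i ^+ 2))).
  rewrite -[X in X - _](mean_cst p cells) -mulN1r -meanZ -meanD.
  apply: le_mean => // G; rewrite mulN1r.
  set good := (X in nat_of_bool X); have [_|/forallPn[i far]] := boolP good.
    by rewrite subrr sumr_ge0 // => i _; rewrite mulr_ge0 ?sqr_ge0 ?divr_ge0 ?sqr_ge0.
  rewrite subr0 (bigD1 i) //= -[leLHS]addr0; apply: lerD; last first.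
    by rewrite sumr_ge0 // => j _; rewrite mulr_ge0 ?sqr_ge0 ?divr_ge0 ?sqr_ge0.
  rewrite -ltNge in far; rewrite mulrAC ler_pdivlMr ?exprn_gt0 // mul1r.
  have h : t / 2 < `|dev G i|.
    have := ler_normD (dev G i) (p * ((z i)%:R - mu i)).
    rewrite /dev subrK normrM (ger0_norm p0) => h1.
    have := small i (ltn_ord i); lra.
  by rewrite -[dev _ _ ^+ 2]real_normK ?num_real //; nra.
have sum_cst (c : R) : m%:R * c = \sum_(i < m) c.
  by rewrite sumr_const card_ord mulr_natl.
rewrite mean_sum [leRHS]sum_cst.
apply: ler_sum => i _; rewrite meanZ ler_wpM2l ?divr_ge0 ?sqr_ge0 //.
apply: le_trans (coupling_second_moment (ltn_ord i)) _.
rewrite lerD2r; apply: lerD; last exact: small.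
rewrite ler_wpM2l ?mulr_ge0 ?sqr_ge0 // ler_wpM2r ?mulr_ge0 //.
by rewrite ler_nat ltnW.
Qed.

End CoupledModel.

(** * The coupling for fixed n *)

Lemma basin_coupling (R : realType) (n m : nat) (p : R) (z : nat -> nat) :
  0 <= p <= 1 ->
  exists (P : probability nat R) (B Z : 'I_m -> {RV P >-> nat}),
    [/\ has_basin_law B n p,
        mutually_independent Z,
        forall (i : 'I_m) (S : set nat),
          distribution P (Z i) S = binomial_prob (z i) p S &
        forall t : R, 0 < t ->
          (forall i, (i < m)%N ->
             p * `|(z i)%:R - (n - m)%:R * (1 - p) ^+ i| <= t / 2) ->
          ((1 - m%:R * (4 / t ^+ 2 * (2 * p ^+ 2 * (m%:R * (n%:R * p)) + t / 2 + 1)))%:E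
           <= P [set w | forall i : 'I_m, (`|(Z i w)%:R - (B i w)%:R : R| <= t)%R])%E].
Proof.
(* A row length that covers every prefix to be read. *)
move=> p01; pose M := (n - m + \sum_(i < m) z i)%N.
have N0M : (n - m <= M)%N by exact: leq_addr.
have zM i : (i < m)%N -> (z i <= M)%N.
  move=> im; apply: leq_trans (leq_addl _ _).
  by rewrite (bigD1 (Ordinal im)) //= leq_addr.
have [P [f Pf]] := bernoulli_probability_space ('I_m * 'I_M)%type p01.
have mnat (g : nat -> nat) : measurable_fun setT g by [].
pose rv (g : nat -> nat) : {RV P >-> nat} :=
  HB.pack g (isMeasurableFun.Build _ _ _ _ g (mnat g)).
pose B (i : 'I_m) := rv (fun w => coupled_basin (n - m) (f w) i).
pose Z (i : 'I_m) := rv (fun w => coupled_binomial z (f w) i).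
have PZ (i : 'I_m) (S : set nat) : P (Z i @^-1` S) =
    (mean p (fun G : {set 'I_m * 'I_M} => `[< S (coupled_binomial z G i) >]%:R))%:E.
  rewrite -(Pf (fun G => `[< S (coupled_binomial z G i) >])); congr (P _).
  by apply/seteqP; split => w /= /asboolP.
exists P, B, Z; split.
(* The laws above take families indexed by [nat], so [x] is extended by 0. *)
- move=> x; pose x' k := if insub k is Some i then x i else 0%N.
  have x'E (i : 'I_m) : x' i = x i by rewrite /x' valK.
  transitivity (P [set w | [forall i : 'I_m, coupled_basin (n - m) (f w) i == x' i]]).
    congr (P _); apply/seteqP; split => w /=.
      by move=> Bx; apply/forallP => i; rewrite x'E -Bx.
    by move=> /forallP Bx i; rewrite -x'E; exact/eqP.
  rewrite (Pf (fun G => [forall i : 'I_m, coupled_basin (n - m) G i == x' i])).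
  rewrite coupled_basin_law // -basin_size_law; congr (_%:E); apply: eq_bigl => G.
  by apply: eq_forallb => i; rewrite x'E.
(* Indices outside [J] receive the always true predicate, whose mean is 1, so only the product over
   [J] remains. *)
- move=> J A; pose Q k j := if insub k is Some i
    then (i \in J) ==> `[< A i j >] else true.
  have QE (i : 'I_m) j : Q i j = (i \in J) ==> `[< A i j >] by rewrite /Q valK.
  transitivity (P [set w | [forall i : 'I_m, Q i (coupled_binomial z (f w) i)]]).
    congr (P _); apply/seteqP; split => w /=.
      by move=> ZA; apply/forallP => i; rewrite QE; apply/implyP => iJ; apply/asboolP/ZA.
    by move=> /forallP ZA i /= iJ; move: (ZA i); rewrite QE iJ => /asboolP.
  rewrite (Pf (fun G => [forall i : 'I_m, Q i (coupled_binomial z G i)])).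
  rewrite coupled_binomial_indep [RHS](eq_bigr _ (fun i _ => PZ i (A i))).
  rewrite prodEFin; congr (_%:E); rewrite [RHS]big_mkcond; apply: eq_bigr => i _.
  case: ifPn => iJ; first by apply: eq_mean => G; rewrite QE iJ.
  by rewrite -[RHS](mean_cst p ('I_m * 'I_M)%type 1); apply: eq_mean => G; rewrite QE (negbTE iJ).
- move=> i S; case/andP: (p01) => p0 p1.
  rewrite /distribution /pushforward PZ.
  rewrite (coupled_binomial_law _ zM (fun k => `[< S k >])) // (@binomial_probE R (z i) p p0 p1).
  rewrite -sumEFin; apply: eq_bigr => k _; rewrite EFinM diracE; congr (_ * _)%E.
- move=> t t0 small.
  have -> : [set w | forall i : 'I_m, `|(Z i w)%:R - (B i w)%:R : R| <= t] =
     [set w | [forall i : 'I_m, `|(coupled_binomial z (f w) i)%:R -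
        (coupled_basin (n - m) (f w) i)%:R : R| <= t]].
    by apply/seteqP; split => w /= => [?|/forallP//]; exact/forallP.
  rewrite (Pf (fun G => [forall i : 'I_m, `|(coupled_binomial z G i)%:R -
        (coupled_basin (n - m) G i)%:R : R| <= t])) lee_fin.
  apply: le_trans (coupling_tail p01 N0M zM t0 small).
  case/andP: p01 => p0 p1.
  rewrite lerD2l lerN2 ler_wpM2l // ler_wpM2l ?divr_ge0 ?sqr_ge0 // 2!lerD2r.
  rewrite ler_wpM2l ?mulr_ge0 ?sqr_ge0 // ler_wpM2l // ler_wpM2r //.
  by rewrite ler_nat leq_subr.
Qed.

(** * Deterministic estimates *)

(** The error e_r of the expansion satisfies e_(r+1) = (1 - p) e_r + r (r - 1) p^3 / 2, and the last
    term is at most ((r + 1)^3 - r^3) p^3. *)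
Lemma one_minus_pow_bounds (R : realType) (p : R) (r : nat) : 0 <= p <= 1 ->
  0 <= 1 - r%:R * p + 2^-1 * (r%:R * (r%:R - 1)) * p ^+ 2 - (1 - p) ^+ r
    <= r%:R ^+ 3 * p ^+ 3.
Proof.
case/andP=> p0 p1; elim: r => [|r]; first by rewrite expr0; apply/andP; split; nra.
set e := (X in 0 <= X <= _) => /andP[e0 e1].
rewrite (exprS (1 - p) r) -natr1; set a := r%:R : R.
have [a0 aa] : 0 <= a /\ 0 <= a * (a - 1).
  split=> //; rewrite /a; case: (r) => [|k]; first by rewrite mul0r.
  by rewrite mulr_ge0 // subr_ge0 ler1n.
set f := (X in 0 <= X <= _).
have -> : f = (1 - p) * e + 2^-1 * (a * (a - 1)) * p ^+ 3 by rewrite /f /e -/a; field.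
have p3 : 0 <= p ^+ 3 by exact: exprn_ge0.
have E1 : 0 <= (1 - p) * e by rewrite mulr_ge0 // subr_ge0.
have E2 : (1 - p) * e <= a ^+ 3 * p ^+ 3.
  by apply: le_trans e1; rewrite ler_piMl //; lra.
have E3 : 0 <= 2^-1 * (a * (a - 1)) * p ^+ 3.
  by rewrite mulr_ge0 // mulr_ge0 // invr_ge0.
have E4 : 2^-1 * (a * (a - 1)) * p ^+ 3 <= ((a + 1) ^+ 3 - a ^+ 3) * p ^+ 3.
  by rewrite ler_wpM2r //; nra.
apply/andP; split; first exact: addr_ge0.
by move: E4; rewrite mulrBl; lra.
Qed.

Lemma rounding_dist (R : realType) (k : nat) (x : R) :
  is_rounding k x -> `|k%:R - x| <= 1.
Proof.
have cast j : (k%:Z = j) -> (k%:R : R) = j%:~R by move=> <-.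
case=> /cast ->; rewrite ler_norml.
  by have /andP[] := floor_itv x; rewrite intrD; lra.
by have /andP[] := ceil_itv x; rewrite intrB; lra.
Qed.

(** Three errors add up: 1 for rounding, n m^3 p^3 for the expansion at r = l - 1, and m for
    replacing n by n - m. *)
Lemma binomial_parameter_dist (R : realType) (p : nat -> R) (n m r k : nat) :
  0 <= p n <= 1 -> (r < m)%N -> is_rounding k (zz p n r.+1) ->
  `|k%:R - (n - m)%:R * (1 - p n) ^+ r|
    <= 1 + n%:R * m%:R ^+ 3 * p n ^+ 3 + m%:R.
Proof.
move=> p01 rm /rounding_dist; rewrite /zz -natr1 addrK.
have -> : r%:R + 1 - 2 = r%:R - 1 :> R by ring.
have := one_minus_pow_bounds r p01; case/andP: (p01) => p0 p1.
set q := p n in p0 p1 *; set a := r%:R : R; set b := (1 - q) ^+ r.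
have b0 : 0 <= b by rewrite exprn_ge0 // subr_ge0.
have b1 : b <= 1 by rewrite exprn_ile1 ?subr_ge0 //; lra.
set e := _ - b => /andP[e0 e1].
have a0 : 0 <= a by [].
have n0 : 0 <= n%:R :> R by [].
have nm0 : n%:R - m%:R <= (n - m)%:R :> R.
  by rewrite lerBlDr -natrD ler_nat; lia.
have nmn : (n - m)%:R <= n%:R :> R by rewrite ler_nat leq_subr.
have -> : n%:R - a * (n%:R * q) + 2^-1 * (a * (a - 1)) * (n%:R * q ^+ 2)
   = n%:R * (e + b) by rewrite /e; ring.
have E1 : n%:R * e <= n%:R * m%:R ^+ 3 * q ^+ 3.
  rewrite -mulrA ler_wpM2l //; apply: le_trans e1 _.
  by rewrite ler_wpM2r ?exprn_ge0 // lerXn2r ?nnegrE // ler_nat ltnW.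
have E0 : 0 <= n%:R * e by exact: mulr_ge0.
have E2 : 0 <= (n%:R - (n - m)%:R) * b by rewrite mulr_ge0 // subr_ge0.
have E3 : (n%:R - (n - m)%:R) * b <= m%:R.
  by apply: (@le_trans _ _ (n%:R - (n - m)%:R)); [rewrite ler_piMr ?subr_ge0 | lra].
rewrite !ler_norml => /andP[h1 h2].
move: h1 h2 E2 E3; rewrite mulrDr mulrBl => *; apply/andP; split; lra.
Qed.

(* To be read with v = n^(1/8), u = n^(eps/2), K = 2k and t = (np)^(2/5). *)
Lemma coupling_bounds (R : realType) (v u D p K t : R) :
  2 <= v -> 1 <= D -> 4 * (D + D ^+ 3) <= u -> 0 < p -> p <= 1 ->
  u ^+ 2 <= p * v ^+ 3 -> v ^+ 8 * p ^+ 3 <= 1 -> v ^+ 2 <= t ->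
  0 <= K -> K * p ^+ 2 * v ^+ 4 <= D * u ->
  p * (1 + v ^+ 8 * K ^+ 3 * p ^+ 3 + K) <= t / 2 /\
  K * (4 / t ^+ 2 * (2 * p ^+ 2 * (K * (v ^+ 8 * p)) + t / 2 + 1))
    <= (8 * D ^+ 2 + 6 * D) / u.
Proof.
move=> v2 D1 Du p0 p1 upv vp vt K0 KD.
have D3 : 1 <= D ^+ 3 by rewrite exprn_ege1.
have u1 : 1 <= u by lra.
have u0 : 0 < u by lra.
have v0 : 0 < v by lra.
have v4 : 4 <= v ^+ 2 by nra.
have t1 : 1 <= t by lra.
have t0 : 0 < t by lra.
(* For K = 2k this is of order (log n)^(1/2), since v^4 = n^(1/2). *)
set a := K * p ^+ 2 * v ^+ 4 in KD.
have a0 : 0 <= a by rewrite mulr_ge0 ?mulr_ge0 ?exprn_ge0 ?(ltW p0) ?(ltW v0).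
(* Squaring u^2 <= p v^3, which encodes np >= n^(5/8 + eps), bounds K u^4 by a v^2; hence K is small
   against v^2 <= t. *)
have Ku : K * u ^+ 3 <= D * v ^+ 2.
  have u4 : u ^+ 4 <= p ^+ 2 * v ^+ 6.
    have -> : u ^+ 4 = (u ^+ 2) ^+ 2 by ring.
    have -> : p ^+ 2 * v ^+ 6 = (p * v ^+ 3) ^+ 2 by ring.
    by rewrite lerXn2r ?nnegrE ?mulr_ge0 ?exprn_ge0 ?(ltW p0) ?(ltW v0) ?(ltW u0).
  rewrite -(ler_pM2r u0); apply: (@le_trans _ _ (a * v ^+ 2)).
    rewrite (_ : _ * u = K * u ^+ 4); last by ring.
    by rewrite (_ : a * _ = K * (p ^+ 2 * v ^+ 6)) ?ler_wpM2l // /a; ring.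
  by rewrite (_ : D * _ * u = (D * u) * v ^+ 2) ?ler_wpM2r ?exprn_ge0 ?(ltW v0) //; ring.
have u23 : u <= u ^+ 3 by rewrite -[leLHS]expr1 ler_weXn2l.
have Ku1 : K * u <= D * v ^+ 2.
  by apply: le_trans Ku; rewrite ler_wpM2l.
have vp1 : v ^+ 2 * p <= 1.
  rewrite -(@expr_le1 _ 3) ?mulr_ge0 ?exprn_ge0 ?(ltW p0) ?(ltW v0) //.
  apply: le_trans vp; rewrite exprMn -exprM ler_wpM2r ?exprn_ge0 ?(ltW p0) //.
  by rewrite ler_weXn2l //; lra.
split.
  (* The expansion error n K^3 p^4 is exactly a^2 K. *)
  have -> : p * (1 + v ^+ 8 * K ^+ 3 * p ^+ 3 + K) = p + a ^+ 2 * K + p * K.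
    by rewrite /a; ring.
  have A1 : a ^+ 2 * K <= D ^+ 2 * u ^+ 2 * K.
    by rewrite ler_wpM2r // -exprMn lerXn2r ?nnegrE ?mulr_ge0 //; lra.
  have A2 : D ^+ 2 * u ^+ 2 * K * u <= D ^+ 3 * v ^+ 2.
    rewrite (_ : D ^+ 3 * _ = D ^+ 2 * (D * v ^+ 2)); last by ring.
    by rewrite (_ : _ * u = D ^+ 2 * (K * u ^+ 3)) ?ler_wpM2l ?exprn_ge0 //; [lra | ring].
  have A3 : p * K <= K by rewrite ler_piMl.
  have A4 : (D ^+ 2 * u ^+ 2 * K + K) * u <= v ^+ 2 / 4 * u.
    apply: (@le_trans _ _ ((D + D ^+ 3) * v ^+ 2)).
      by rewrite !mulrDl; lra.
    rewrite [leRHS](_ : _ = u / 4 * v ^+ 2); last by field.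
    by rewrite ler_wpM2r ?exprn_ge0 ?(ltW v0) //; lra.
  rewrite ler_pM2r // in A4; lra.
have tv : v ^+ 4 <= t ^+ 2.
  have -> : v ^+ 4 = (v ^+ 2) ^+ 2 by ring.
  by rewrite lerXn2r ?nnegrE //; lra.
rewrite ler_pdivlMr //.
(* The share of [t / 2 + 1] is at most 6 K / t because t >= 1. *)
have B1 : K * (4 / t ^+ 2 * (t / 2 + 1)) * u <= 6 * D.
  apply: (@le_trans _ _ (6 * (K * u / t))).
    rewrite [leRHS](_ : _ = K * u * (6 / t)); last by field; lra.
    rewrite mulrAC ler_wpM2l ?mulr_ge0 ?(ltW u0) //.
    rewrite (_ : 4 / t ^+ 2 * (t / 2 + 1) = (2 + 4 / t) / t); last by field; lra.
    rewrite ler_pM2r ?invr_gt0 //.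
    have : 4 / t <= 4 by rewrite ler_pdivrMr //; lra.
    by lra.
  rewrite ler_pM2l // ler_pdivrMr //; apply: le_trans Ku1 _.
  by rewrite ler_wpM2l //; lra.
(* The variance share is 8 a K p v^4 / t^2, controlled by v^4 <= t^2 and v^2 p <= 1. *)
have B2 : K * (4 / t ^+ 2 * (2 * p ^+ 2 * (K * (v ^+ 8 * p)))) * u <= 8 * D ^+ 2.
  rewrite (_ : _ * u = 8 * (a * K * p * u * (v ^+ 4 / t ^+ 2))); last first.
    by rewrite /a; field; lra.
  rewrite ler_pM2l //; apply: (@le_trans _ _ (a * K * p * u)).
    have aKpu := mulr_ge0 (mulr_ge0 (mulr_ge0 a0 K0) (ltW p0)) (ltW u0).
    by rewrite ler_piMr // ler_pdivrMr ?exprn_gt0 // mul1r.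
  apply: (@le_trans _ _ (D * u * K * p * u)).
    by rewrite !ler_wpM2r ?(ltW u0) ?(ltW p0).
  rewrite (_ : _ * u = D * (K * u ^+ 2) * p); last by ring.
  apply: (@le_trans _ _ (D * (D * v ^+ 2) * p)).
    rewrite ler_wpM2r ?(ltW p0) // ler_wpM2l //; first lra.
    by apply: le_trans Ku; rewrite ler_wpM2l // ler_weXn2l.
  rewrite (_ : _ * p = D ^+ 2 * (v ^+ 2 * p)); last by ring.
  by rewrite ler_piMr ?exprn_ge0 //; lra.
rewrite (_ : _ * u = K * (4 / t ^+ 2 * (2 * p ^+ 2 * (K * (v ^+ 8 * p)))) * u +
   K * (4 / t ^+ 2 * (t / 2 + 1)) * u); last by ring.
exact: lerD.
Qed.

(** * Asymptotics in n *)

Lemma near_powR_ge (R : realType) (a A : R) : 0 < a ->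
  \forall n \near \oo, A <= n%:R `^ a.
Proof.
move=> a0; pose b := Num.max A 0.
have b0 : 0 <= b by rewrite le_max lexx orbT.
near=> n; have bn : b `^ a^-1 <= n%:R by near: n; exact: cvgry_ge (@cvgr_idn R) _.
apply: (@le_trans _ _ b); first by rewrite le_max lexx.
have {1}-> : b = (b `^ a^-1) `^ a by rewrite -powRrM mulVf ?gt_eqF // powRr1.
by apply: ge0_ler_powR; rewrite ?nnegrE ?powR_ge0 // ltW.
Unshelve. all: by end_near.
Qed.

Lemma cvg_div_powR (R : realType) (a c : R) : 0 < a ->
  (c / n%:R `^ a) @[n --> \oo] --> (0 : R).
Proof.
move=> a0; apply/cvgr0Pnorm_le => delta delta0.
have := near_powR_ge (1 + `|c| / delta) a0; apply: filterS => n h.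
have cd : 0 <= `|c| / delta by rewrite divr_ge0 // ltW.
have q0 : 0 < n%:R `^ a by apply: lt_le_trans h; rewrite ltr_wpDr.
rewrite normrM normfV (gtr0_norm q0) ler_pdivrMr // -ler_pdivrMl // mulrC.
by apply: le_trans h; rewrite lerDr.
Qed.

(** The ceiling costs at most p^2, itself at most the square root s; doubling 15 s + s gives 32
    s. *)
Lemma kk_le (R : realType) (p : nat -> R) (n : nat) : 0 < p n ->
  p n ^+ 2 <= Num.sqrt (n%:R^-1 * ln n%:R) ->
  (2 * kk p n)%:R * p n ^+ 2 <= 32 * Num.sqrt (n%:R^-1 * ln n%:R).
Proof.
rewrite /kk; set q := p n; set s := Num.sqrt _ => q0 qs.
have q2 : 0 < q ^+ 2 by rewrite exprn_gt0.
set x := 15 * q ^- 2 * s; have xq : x * q ^+ 2 = 15 * s by rewrite /x; field; lra.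
have x0 : 0 <= x by rewrite /x !mulr_ge0 ?sqrtr_ge0 // invr_ge0 ltW.
have k_le : `|Num.ceil x|%:R <= x + 1.
  rewrite natr_absz ger0_norm; last by rewrite -(ler_int R); apply: le_trans (ceil_ge x).
  by have /andP[] := ceil_itv x; rewrite intrB; lra.
have : `|Num.ceil x|%:R * q ^+ 2 <= (x + 1) * q ^+ 2 by rewrite ler_pM2r.
rewrite natrM mulrDl xq; lra.
Qed.

Lemma near_coupling_bounds (R : realType) (eps : R) (p : nat -> R) :
  0 < eps < 1 / 24 ->
  (forall n, 0 <= p n <= 1) ->
  (forall n, (0 < n)%N -> n%:R `^ (5 / 8 + eps) <= n%:R * p n) ->
  (fun n => n%:R * p n : R^o) =o_\oo (fun n => n%:R `^ (2 / 3) : R^o) ->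
  exists c : R, \forall n \near \oo,
    let t := (n%:R * p n) `^ (2 / 5) in let K := (2 * kk p n)%:R in
    [/\ 0 < t,
        p n * (1 + n%:R * K ^+ 3 * p n ^+ 3 + K) <= t / 2 &
        K * (4 / t ^+ 2 * (2 * p n ^+ 2 * (K * (n%:R * p n)) + t / 2 + 1))
          <= c / n%:R `^ (eps / 2)].
Proof.
move=> /andP[eps0 eps1] p01 p_ge p_ll.
(* The 32 comes from [kk_le], the 1/eps from eps ln n <= n^eps. *)
pose D := 32 / eps.
have D1 : 1 <= D by rewrite /D ler_pdivlMr //; lra.
exists (8 * D ^+ 2 + 6 * D).
have p_le : \forall n \near \oo, n%:R * p n <= n%:R `^ (2 / 3).
  have /eqoP/(_ 1 ltr01) := p_ll; apply: filterS => n /=.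
  rewrite mul1r ger0_norm ?ger0_norm ?powR_ge0 //.
  by rewrite mulr_ge0 //; have /andP[] := p01 n.
have eps2 : 0 < eps / 2 by lra.
have e8 : 0 < 1 / 8 :> R by lra.
near=> n; cbv zeta.
(* Ensures ln n >= 1, used below to compare p^2 with the square root in k. *)
have Nexp : expR 1 <= n%:R :> R by near: n; exact: cvgry_ge (@cvgr_idn R) _.
have v2 : 2 <= n%:R `^ (1 / 8) :> R by near: n; exact: near_powR_ge.
have uD : 4 * (D + D ^+ 3) <= n%:R `^ (eps / 2) by near: n; exact: near_powR_ge.
have Np : n%:R * p n <= n%:R `^ (2 / 3) by near: n.
move: Nexp v2 uD Np; set N : R := n%:R; move=> Nexp v2 uD Np.
set K := (2 * kk p n)%:R; set t := _ `^ (2 / 5).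
have N1 : 1 <= N by apply: le_trans Nexp; have := expR_ge1Dx (1 : R); lra.
have N0 : 0 < N by lra.
have Nneq0 : N != 0 by lra.
have n0 : (0 < n)%N by rewrite -(ltr_nat R).
have lnN : 1 <= ln N by rewrite -(expRK 1) ler_ln ?posrE ?expR_gt0.
set v := N `^ (1 / 8) in v2; set u := N `^ (eps / 2) in uD *.
have powN (a : R) k : (N `^ a) ^+ k = N `^ (a * k%:R).
  by rewrite powRrM powR_mulrn ?powR_ge0.
have v8 : v ^+ 8 = N by rewrite powN (_ : _ * _ = 1) ?powRr1 ?(ltW N0) //; lra.
have v0 : 0 < v by lra.
have u0 : 0 < u by exact: powR_gt0.
have /andP[p0' p1] := p01 n.
(* The lower bound on np, divided by v^5 = n^(5/8). *)
have up : u ^+ 2 <= p n * v ^+ 3.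
  rewrite -(@ler_pM2l _ (v ^+ 5)) ?exprn_gt0 //.
  rewrite [leRHS](_ : _ = N * p n); last by rewrite -v8; ring.
  apply: le_trans (p_ge n n0); rewrite !powN -powRD ?Nneq0 ?implybT //.
  by apply: ler_powR => //; lra.
have p0 : 0 < p n.
  rewrite -(@pmulr_lgt0 _ (v ^+ 3)) ?exprn_gt0 //.
  by apply: lt_le_trans up; rewrite exprn_gt0.
have Np3 : N * p n ^+ 3 <= 1.
  rewrite -(@ler_pM2l _ (N ^+ 2)) ?exprn_gt0 // mulr1.
  rewrite [leLHS](_ : _ = (N * p n) ^+ 3); last by ring.
  apply: (@le_trans _ _ ((N `^ (2 / 3)) ^+ 3)).
    by rewrite lerXn2r ?nnegrE ?powR_ge0 ?mulr_ge0 ?(ltW N0).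
  rewrite powN -powR_mulrn ?(ltW N0) //; apply: ler_powR => //; lra.
have tv : v ^+ 2 <= t.
  apply: (@le_trans _ _ ((N `^ (5 / 8 + eps)) `^ (2 / 5))).
    by rewrite powN -powRrM; apply: ler_powR => //; lra.
  apply: ge0_ler_powR; rewrite ?nnegrE ?powR_ge0 ?mulr_ge0 ?(ltW N0) ?p_ge //.
have KD : K * p n ^+ 2 * v ^+ 4 <= D * u.
  have v4 : 0 < v ^+ 4 by rewrite exprn_gt0.
  (* This is ln x < x at x = n^eps = u^2. *)
  have u_ln : eps * ln N <= u ^+ 2.
    rewrite -ln_powR powN (_ : _ * 2%:R = eps); last by field.
    by apply/ltW/ln_sublinear/powR_gt0.
  set s := Num.sqrt (N^-1 * ln N).
  (* Amounts to n p^4 <= ln n, and n p^4 = p (n p^3) <= 1. *)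
  have ps : p n ^+ 2 <= s.
    rewrite /s -[leLHS]ger0_norm ?sqr_ge0 // -sqrtr_sqr ler_wsqrtr // ler_pdivlMl //.
    apply: le_trans lnN; rewrite (_ : N * _ = p n * (N * p n ^+ 3)); last by ring.
    by rewrite -[leRHS]mulr1 ler_pM // mulr_ge0 ?exprn_ge0 ?(ltW N0).
  have sv : s * v ^+ 4 <= u / eps.
    rewrite -ler_pdivlMr // -[leRHS]ger0_norm; last by rewrite !divr_ge0 ?ltW.
    rewrite -sqrtr_sqr ler_wsqrtr //.
    rewrite [leRHS](_ : _ = N^-1 * (u ^+ 2 / eps ^+ 2)); last by rewrite -v8; field; lra.
    rewrite ler_pM2l ?invr_gt0 // ler_pdivlMr ?exprn_gt0 //.
    apply: le_trans u_ln; rewrite expr2 mulrA mulrC ler_pM2l //.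
    by rewrite ler_piMr //; lra.
  have := kk_le p0 ps; rewrite -/K -/N -/s -(ler_pM2r v4) => /le_trans; apply.
  by rewrite -mulrA /D; lra.
have K0 : 0 <= K by [].
have := coupling_bounds v2 D1 uD p0 p1 up _ tv K0 KD; rewrite v8 => /(_ Np3)[h1 h2].
by split => //; apply: lt_le_trans tv; rewrite exprn_gt0.
Unshelve. all: by end_near.
Qed.

(** The random variables are typed over the chosen probability, so the choice over all n must be
    dependent. *)
Lemma choice_exists3 (I : Type) (X : I -> Type) (Y Z : forall i, X i -> Type)
    (Q : forall i x, Y i x -> Z i x -> Prop) :
  (forall i, exists x y z, Q i x y z) ->
  exists (x : forall i, X i) (y : forall i, Y i (x i)) (z : forall i, Z i (x i)),
    forall i, Q i (x i) (y i) (z i).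
Proof.
move=> xyz; exists (fun i => sval (cid (xyz i))).
exists (fun i => sval (cid (svalP (cid (xyz i))))).
exists (fun i => sval (cid (svalP (cid (svalP (cid (xyz i))))))) => i.
exact: (svalP (cid (svalP (cid (svalP (cid (xyz i))))))).
Qed.

(** * Passage to the limit *)

Theorem lemma3p22 (R : realType) (eps : R) (p : nat -> R)
    (z : nat -> nat -> nat) :
  0 < eps < 1 / 24 ->
  (forall n, 0 <= p n <= 1) ->
  (forall n, (0 < n)%N -> n%:R `^ (5 / 8 + eps) <= n%:R * p n) ->
  (fun n => n%:R * p n : R^o) =o_\oo (fun n => n%:R `^ (2 / 3) : R^o) ->
  (forall n l, (1 <= l <= 2 * kk p n)%N -> is_rounding (z n l) (zz p n l)) ->
  exists (d : nat -> measure_display) (T : forall n, measurableType (d n))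
         (P : forall n, probability (T n) R)
         (B Z : forall n, 'I_(2 * kk p n) -> {RV (P n) >-> nat}),
    (forall n, has_basin_law (B n) n (p n)) /\
    (forall n, mutually_independent (Z n)) /\
    (forall n (i : 'I_(2 * kk p n)) (S : set nat),
        distribution (P n) (Z n i) S = binomial_prob (z n i.+1) (p n) S) /\
    P n [set w | forall i : 'I_(2 * kk p n),
          `|(Z n i w)%:R - (B n i w)%:R : R| <= (n%:R * p n) `^ (2 / 5)]
      @[n --> \oo] --> 1%E.
Proof.
move=> eps01 p01 p_ge p_ll z_round.
have [c near_bounds] := near_coupling_bounds eps01 p01 p_ge p_ll.
(* Row [i] serves v_(i+1), hence the shift in the index of [z]. *)
have cpl n := basin_coupling n (2 * kk p n) (fun i => z n i.+1) (p01 n).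
have [P [B [Z PBZ]]] := choice_exists3 cpl.
exists (fun=> _), (fun=> nat : measurableType _), P, B, Z.
split; first by move=> n; have [] := PBZ n.
split; first by move=> n; have [] := PBZ n.
split; first by move=> n; have [] := PBZ n.
have eps2 : 0 < eps / 2 by rewrite divr_gt0 //; case/andP: eps01.
(* The probability lies between 1 - c n^(-eps/2), for large n, and 1. *)
apply: (@squeeze_cvge _ _ _ _ (fun n => (1 - c / n%:R `^ (eps / 2))%:E) _ (fun=> 1%E)).
- move: near_bounds; apply: filterS => n [t0 small tail].
  apply/andP; split; last exact: probability_le1.
  have [_ _ _ cpl_n] := PBZ n.
  apply: le_trans (cpl_n _ t0 _); first by rewrite lee_fin lerD2l lerN2.
  move=> i im; apply: le_trans small.
  have /andP[p0 p1] := p01 n.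
  rewrite ler_wpM2l //; apply: binomial_parameter_dist => //.
  exact: z_round.
- apply: cvg_EFin; first by near=> n.
  rewrite -[X in _ --> X]subr0; apply: cvgB; [exact: cvg_cst | exact: cvg_div_powR].
- exact: cvg_cst.
Unshelve. all: by end_near.
Qed.
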